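(* Let $W\subset S^1$ with $|W|=5$. Then $P(W)$ holds unless $W\cong\{0,\tfrac15,\tfrac25,\tfrac35,\tfrac45\}$ (the vertex set of a regular pentagon).
   Context: Identify $S^1$ with $\mathbb{R}/\mathbb{Z}$. The group $O(2)$ acts on $S^1$ by translations $x\mapsto x+a$ and reflections $x\mapsto -x+2a$. A coloring $c:S^1\to\{R,B\}$ is distinguishing if no non-identity $\gamma\in O(2)$ satisfies $c\circ\gamma=c$. For $W\subset S^1$ with trivial pointwise stabilizer in $O(2)$, $P(W)$ holds if every precoloring $c:S^1\setminus W\to\{R,B\}$ extends to a distinguishing coloring of $S^1$. Write $W\cong W'$ if $W'=\gamma(W)$ for some $\gamma\in O(2)$. *)

(* Defs.v *)
From Stdlib Require Import Reals List.
Open Scope R_scope.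

(* S^1 = R/Z: points are represented by reals, identified modulo integers. *)
Definition cong1 (x y : R) : Prop := exists z : Z, x = y + IZR z.

Definition O2 := (bool * R)%type.
Definition act (g : O2) (x : R) : R :=
  if fst g then - x + 2 * snd g else x + snd g.

Definition is_identity (g : O2) : Prop := forall x, cong1 (act g x) x.

(* A coloring of S^1 with colours {R,B} = bool: a 1-periodic map R -> bool. *)
Definition coloring (c : R -> bool) : Prop := forall x, c (x + 1) = c x.

Definition distinguishing (c : R -> bool) : Prop :=
  forall g : O2, (forall x, c (act g x) = c x) -> is_identity g.

(* membership in W (a finite subset of S^1 given by representatives) *)
Definition inW (W : list R) (x : R) : Prop := exists w, In w W /\ cong1 x w.

Definition trivial_stab (W : list R) : Prop :=
  forall g : O2, (forall w, In w W -> cong1 (act g w) w) -> is_identity g.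

(* P(W): every precoloring of S^1 \ W extends to a distinguishing coloring.
   A precoloring is represented by any 1-periodic function whose values on W
   are ignored. *)
Definition P (W : list R) : Prop :=
  forall c : R -> bool, coloring c ->
    exists c' : R -> bool, coloring c' /\
      (forall x, ~ inW W x -> c' x = c x) /\ distinguishing c'.

Definition congruent (W W' : list R) : Prop :=
  exists g : O2, forall x, inW W' x <-> exists w, In w W /\ cong1 x (act g w).

Definition distinct_pts (W : list R) : Prop :=
  forall i j, (i < length W)%nat -> (j < length W)%nat -> i <> j ->
    ~ cong1 (nth i W 0) (nth j W 0).

Definition pentagon : list R := 0 :: 1/5 :: 2/5 :: 3/5 :: 4/5 :: nil.

(* Main.v *)
Require Import Defs.
From Stdlib Require Import Reals List.
From Stdlib Require Import Lra Lia ZArith Classical ClassicalEpsilon Permutation Sorted.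
From Coquelicot Require Import Complex.
Open Scope R_scope.

(** Every five-point set other than the regular pentagon contains a scalene triple a, b, c, and
    recoloring these three points already suffices.  For finitely many red points X, a symmetric
    X has Im (Z2 * conj Z1 ^ 2) = 0, where Zk is the sum of e^(2 pi i k x) over X: a rotation
    forces Z1 = 0, and a reflection puts Z1 ^ 2 and Z2 on a common real line.  If all eight
    recolorings were symmetric, the mixed third difference of this cubic expression in the
    three colors would vanish; writing a, b, c for the unit complex numbers, it is a unit times
    (a^2 - bc)(b^2 - ca)(c^2 - ab), so the triple would be isosceles.

    For an arbitrary coloring the sums Zk diverge, but its differences under the symmetries
    of the recolorings are finitely supported and so have well-defined moments.  These form a
    cocycle of a subgroup of O(2), which is a coboundary because rotations commute; the
    resulting fixed point serves as a regularised value of Zk. *)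

(** * Points modulo 1 *)

Lemma cong1_refl x : cong1 x x.
Proof. exists 0%Z; lra. Qed.

Lemma cong1_sym x y : cong1 x y -> cong1 y x.
Proof. intros [z ->]; exists (- z)%Z; rewrite opp_IZR; lra. Qed.

Lemma cong1_trans x y z : cong1 x y -> cong1 y z -> cong1 x z.
Proof. intros [m ->] [n ->]; exists (n + m)%Z; rewrite plus_IZR; lra. Qed.

Lemma coloring_Z c : coloring c -> forall z x, c (x + IZR z) = c x.
Proof.
  intros H.
  assert (Hn : forall n x, c (x + INR n) = c x).
  { induction n as [|n IH]; intros x.
    - simpl; f_equal; lra.
    - rewrite S_INR, <- Rplus_assoc, H; apply IH. }
  intros z x; destruct (Z_le_gt_dec 0 z) as [Hz|Hz].
  - rewrite <- (Z2Nat.id z Hz), <- INR_IZR_INZ; apply Hn.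
  - rewrite <- (Hn (Z.to_nat (- z)) (x + IZR z)), INR_IZR_INZ, Z2Nat.id by lia.
    rewrite opp_IZR; f_equal; lra.
Qed.

Definition ind (p x : R) : R :=
  if excluded_middle_informative (cong1 x p) then 1 else 0.

Lemma ind_iff p q x y : (cong1 x p <-> cong1 y q) -> ind p x = ind q y.
Proof.
  intros H; unfold ind; destruct excluded_middle_informative as [h|h];
    destruct excluded_middle_informative as [h'|h']; tauto.
Qed.

Lemma ind_self p : ind p p = 1.
Proof.
  unfold ind; destruct excluded_middle_informative as [_|n]; [reflexivity|].
  destruct n; apply cong1_refl.
Qed.

(** * Characters of the circle *)

Definition cis (x : R) : C := (cos (2 * PI * x), sin (2 * PI * x)).

Lemma cis_plus x y : cis (x + y) = Cmult (cis x) (cis y).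
Proof.
  unfold cis, Cmult; simpl.
  rewrite Rmult_plus_distr_l, cos_plus, sin_plus; f_equal; ring.
Qed.

Lemma cis_conj x : Cconj (cis x) = cis (- x).
Proof.
  unfold cis, Cconj; simpl.
  rewrite Ropp_mult_distr_r_reverse, cos_neg, sin_neg; reflexivity.
Qed.

Lemma cis_Z z : cis (IZR z) = RtoC 1.
Proof.
  assert (Hs : sin (PI * IZR z) = 0) by (apply sin_eq_0_1; exists z; ring).
  unfold cis, RtoC; rewrite Rmult_assoc, cos_2a_sin, sin_2a, Hs.
  f_equal; ring.
Qed.

Lemma cis_eq_1 x : cis x = RtoC 1 -> exists z, x = IZR z.
Proof.
  unfold cis, RtoC; intros H; injection H as Hc _.
  rewrite Rmult_assoc, cos_2a_sin in Hc.
  assert (Hs : sin (PI * x) = 0) by nra.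
  apply sin_eq_0_0 in Hs; destruct Hs as [z Hz]; exists z.
  pose proof PI_RGT_0; apply (Rmult_eq_reg_l PI); lra.
Qed.

(** The kernel may contain half-integers, so that both [cis] and its square qualify. A rotation on
    which such a character is trivial has order at most two. *)
Record character (e : R -> C) : Prop := {
  char_plus : forall x y, e (x + y) = Cmult (e x) (e y);
  char_conj : forall x, Cconj (e x) = e (- x);
  char_Z : forall z, e (IZR z) = RtoC 1;
  char_ker : forall x, e x = RtoC 1 -> exists z, 2 * x = IZR z }.

Lemma cis_character : character cis.
Proof.
  split; [apply cis_plus|apply cis_conj|apply cis_Z|].
  intros x H; apply cis_eq_1 in H; destruct H as [z ->].
  exists (2 * z)%Z; rewrite mult_IZR; reflexivity.
Qed.

Lemma cis2_character : character (fun x => cis (2 * x)).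
Proof.
  split.
  - intros x y; rewrite Rmult_plus_distr_l; apply cis_plus.
  - intros x; rewrite cis_conj; f_equal; ring.
  - intros z; rewrite <- mult_IZR; apply cis_Z.
  - intros x; apply cis_eq_1.
Qed.

Lemma char_cong1 e x y : character e -> cong1 x y -> e x = e y.
Proof.
  intros He [z ->]; rewrite (char_plus e He), (char_Z e He); ring.
Qed.

Lemma char_inv e x : character e -> Cmult (e x) (e (- x)) = RtoC 1.
Proof.
  intros He; rewrite <- (char_plus e He), <- (char_Z e He 0); f_equal; simpl; ring.
Qed.

Lemma Cconj_RtoC r : Cconj (RtoC r) = RtoC r.
Proof. unfold Cconj, RtoC; simpl; f_equal; ring. Qed.

(** * Moments of finitely supported functions *)

(** A list of weighted points is a finite formal sum in which repetitions and different
    representatives modulo 1 are allowed. By [msum_zero] its moments depend only on the function it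
    represents. *)
Fixpoint fsupp (L : list (R * R)) (x : R) : R :=
  match L with
  | nil => 0
  | (r, p) :: L' => r * ind p x + fsupp L' x
  end.

Fixpoint msum (e : R -> C) (L : list (R * R)) : C :=
  match L with
  | nil => RtoC 0
  | (r, p) :: L' => Cplus (Cmult (RtoC r) (e p)) (msum e L')
  end.

Lemma fsupp_app L L' x : fsupp (L ++ L') x = fsupp L x + fsupp L' x.
Proof. induction L as [|[r p] L IH]; simpl; [|rewrite IH]; ring. Qed.

Lemma msum_app e L L' : msum e (L ++ L') = Cplus (msum e L) (msum e L').
Proof. induction L as [|[r p] L IH]; simpl; [|rewrite IH]; ring. Qed.

Lemma fsupp_scale s L x :
  fsupp (map (fun q => (s * fst q, snd q)) L) x = s * fsupp L x.
Proof. induction L as [|[r p] L IH]; simpl; [|rewrite IH]; ring. Qed.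

Lemma msum_scale e s L :
  msum e (map (fun q => (s * fst q, snd q)) L) = Cmult (RtoC s) (msum e L).
Proof. induction L as [|[r p] L IH]; simpl; [|rewrite IH, RtoC_mult]; ring. Qed.

(** Gathers all entries congruent to [p] into one term; the length bound feeds the strong induction
    in [msum_zero]. *)
Lemma fsupp_split L p : exists L',
  (length L' <= length L)%nat /\
  (forall x, fsupp L x = fsupp L p * ind p x + fsupp L' x) /\
  (forall e, character e ->
     msum e L = Cplus (Cmult (RtoC (fsupp L p)) (e p)) (msum e L')).
Proof.
  induction L as [|[r q] L (L' & Hl & Hf & Hm)].
  - exists nil; simpl; repeat split; intros; [lia|ring|ring].
  - destruct (classic (cong1 p q)) as [Hpq|Hpq].
    + assert (E : forall x, ind q x = ind p x).
      { intros x; apply ind_iff; split; intros H; eapply cong1_trans; eauto using cong1_sym. }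
      exists L'; simpl; repeat split.
      * lia.
      * intros x; rewrite !E, Hf, ind_self; ring.
      * intros e He; rewrite (Hm e He), E, ind_self, <- (char_cong1 e p q He Hpq).
        rewrite Rmult_1_r, RtoC_plus; ring.
    + assert (E0 : ind q p = 0).
      { unfold ind; destruct excluded_middle_informative; [contradiction|reflexivity]. }
      exists ((r, q) :: L'); simpl; repeat split.
      * lia.
      * intros x; rewrite E0, Hf; ring.
      * intros e He; rewrite (Hm e He), E0, Rmult_0_r, Rplus_0_l; ring.
Qed.

(** Split off the class of the first point. Evaluating there shows that its total weight is zero,
    and a shorter list representing zero remains. *)
Lemma msum_zero e L : character e -> (forall x, fsupp L x = 0) -> msum e L = RtoC 0.
Proof.
  intros He; remember (length L) as n eqn:Hn.
  revert L Hn; induction n as [n IH] using lt_wf_ind; intros L Hn H.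
  destruct L as [|[r p] L]; [reflexivity|].
  destruct (fsupp_split L p) as (L' & Hl & Hf & Hm).
  assert (H0 : r + fsupp L p = 0).
  { specialize (H p); simpl in H; rewrite ind_self in H; lra. }
  simpl; rewrite (Hm e He), (IH (length L')) with (L := L').
  - replace (fsupp L p) with (- r) by lra; rewrite RtoC_opp; ring.
  - simpl in Hn; lia.
  - reflexivity.
  - intros x; specialize (H x); simpl in H; rewrite Hf in H.
    replace (fsupp L p) with (- r) in H by lra; lra.
Qed.

Definition has_moment (e : R -> C) (f : R -> R) (z : C) : Prop :=
  exists L, (forall x, f x = fsupp L x) /\ z = msum e L.

Lemma has_moment_ext e f g z :
  (forall x, f x = g x) -> has_moment e f z -> has_moment e g z.
Proof. intros E (L & Hf & Hz); exists L; split; [intros x; rewrite <- E|]; auto. Qed.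

Lemma has_moment_zero e : has_moment e (fun _ => 0) (RtoC 0).
Proof. exists nil; split; reflexivity. Qed.

Lemma has_moment_plus e f g z w :
  has_moment e f z -> has_moment e g w ->
  has_moment e (fun x => f x + g x) (Cplus z w).
Proof.
  intros (L & Hf & ->) (L' & Hg & ->); exists (L ++ L'); split.
  - intros x; rewrite fsupp_app, Hf, Hg; reflexivity.
  - rewrite msum_app; reflexivity.
Qed.

Lemma has_moment_scale e s f z :
  has_moment e f z -> has_moment e (fun x => s * f x) (Cmult (RtoC s) z).
Proof.
  intros (L & Hf & ->); exists (map (fun q => (s * fst q, snd q)) L); split.
  - intros x; rewrite fsupp_scale, Hf; reflexivity.
  - rewrite msum_scale; reflexivity.
Qed.

Lemma has_moment_minus e f g z w :
  has_moment e f z -> has_moment e g w ->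
  has_moment e (fun x => f x - g x) (Cminus z w).
Proof.
  intros Hf Hg.
  replace (Cminus z w) with (Cplus z (Cmult (RtoC (- (1))) w))
    by (rewrite RtoC_opp; ring).
  apply has_moment_ext with (fun x => f x + - (1) * g x); [intros; ring|].
  apply has_moment_plus; [|apply has_moment_scale]; assumption.
Qed.

Lemma has_moment_ind e p : has_moment e (ind p) (e p).
Proof.
  exists ((1, p) :: nil); split; simpl; [intros|]; ring.
Qed.

Lemma has_moment_unique e f z w :
  character e -> has_moment e f z -> has_moment e f w -> z = w.
Proof.
  intros He Hz Hw.
  destruct (has_moment_minus e f f z w Hz Hw) as (L & HL & E).
  rewrite msum_zero in E; [|assumption|intros x; rewrite <- HL; ring].
  replace z with (Cplus (Cminus z w) w) by ring; rewrite E; ring.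
Qed.

(* The action on moments induced by [f |-> fun x => f (act g x)]. *)
Definition mact (e : R -> C) (g : O2) (z : C) : C :=
  if fst g then Cmult (e (2 * snd g)) (Cconj z) else Cmult (e (- snd g)) z.

Lemma mact_plus e g z w : mact e g (Cplus z w) = Cplus (mact e g z) (mact e g w).
Proof.
  unfold mact; destruct (fst g); [rewrite Cplus_conj|]; ring.
Qed.

Definition inv_act (g : O2) (p : R) : R :=
  if fst g then - p + 2 * snd g else p - snd g.

Lemma inv_act_cong1 g p x : cong1 (act g x) p <-> cong1 x (inv_act g p).
Proof.
  unfold act, inv_act; destruct (fst g); split; intros [z Hz].
  - exists (- z)%Z; rewrite opp_IZR; lra.
  - exists (- z)%Z; rewrite opp_IZR; lra.
  - exists z; lra.
  - exists z; lra.
Qed.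

(** Composition with g carries a mass at p to the preimage of p. The branches of [mact] are e(p - a)
    = e(-a) e(p) and e(2a - p) = e(2a) conj(e(p)). *)
Lemma has_moment_act e g f z : character e ->
  has_moment e f z -> has_moment e (fun x => f (act g x)) (mact e g z).
Proof.
  intros He (L & Hf & ->).
  exists (map (fun q => (fst q, inv_act g (snd q))) L); split.
  - intros x; rewrite Hf; clear Hf; induction L as [|[r p] L IH]; simpl; [reflexivity|].
    rewrite IH; f_equal; f_equal; apply ind_iff, inv_act_cong1.
  - clear Hf; induction L as [|[r p] L IH]; simpl.
    + unfold mact; destruct (fst g); [rewrite Cconj_RtoC|]; ring.
    + rewrite mact_plus, IH; f_equal; unfold mact, inv_act; destruct (fst g).
      * rewrite Cmult_conj, (char_conj e He), (char_plus e He).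
        rewrite Cconj_RtoC; ring.
      * unfold Rminus; rewrite (char_plus e He); ring.
Qed.

(** * Regularised moments of functions with infinite support *)

Lemma Cmult_zero z w : Cmult z w = RtoC 0 -> z = RtoC 0 \/ w = RtoC 0.
Proof.
  intros H; apply NNPP; intros N.
  apply (Cmult_neq_0 z w); tauto.
Qed.

Lemma Ceq_minus z w : Cminus z w = RtoC 0 -> z = w.
Proof. intros H; replace z with (Cplus (Cminus z w) w) by ring; rewrite H; ring. Qed.

Lemma Cdouble_zero z : Cplus z z = RtoC 0 -> z = RtoC 0.
Proof.
  destruct z as [x y]; unfold Cplus, RtoC; simpl; intros H; injection H as Hx Hy.
  f_equal; lra.
Qed.

(* Regularised moment: a fixed point of the affine action of the almost-symmetries of [f],
   playing the role of the divergent sum [sum_x f(x) e(x)]. *)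
Definition regular_moment (e : R -> C) (f : R -> R) (S : C) : Prop :=
  forall g z, has_moment e (fun x => f x - f (act g x)) z -> z = Cminus S (mact e g S).

(** A regular moment must be fixed by S -> z0 + e(-t) S, whose only fixed point is this quotient. It
    suits all other almost-symmetries too, because the rotation by t commutes with rotations and is
    inverted by reflections. *)
Lemma regular_moment_of_rotation e f t z0 : character e ->
  has_moment e (fun x => f x - f (x + t)) z0 -> e t <> RtoC 1 ->
  regular_moment e f (Cdiv z0 (Cminus (RtoC 1) (e (- t)))).
Proof.
  intros He H0 Ht.
  pose proof (char_inv e t He) as Hinv.
  assert (D : Cminus (RtoC 1) (e (- t)) <> RtoC 0).
  { intros E; apply Ht; apply Ceq_minus in E; rewrite <- E in Hinv.
    rewrite <- Hinv; ring. }
  assert (D' : Cminus (RtoC 1) (e t) <> RtoC 0).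
  { intros E; apply Ht; apply Ceq_minus in E; auto. }
  (* Both sides of the cocycle relation for g and the rotation by t have the same moment. *)
  intros [[] a] z Hz.
  - assert (Hl := has_moment_minus _ _ _ _ _ Hz (has_moment_act e (false, t) _ _ He Hz)).
    assert (Hr := has_moment_plus _ _ _ _ _ H0
      (has_moment_act e (true, a) _ _ He (has_moment_act e (false, - t) _ _ He H0))).
    assert (E : Cminus z (mact e (false, t) z) =
                Cplus z0 (mact e (true, a) (mact e (false, - t) z0))).
    { apply (has_moment_unique e _ _ _ He Hl).
      eapply has_moment_ext; [|exact Hr].
      intros x; unfold act; simpl.
      replace (- x + 2 * a + - t + t) with (- x + 2 * a) by ring.
      replace (- (x + t) + 2 * a) with (- x + 2 * a + - t) by ring; ring. }
    unfold mact in *; simpl in *.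
    rewrite Ropp_involutive, Cmult_conj, (char_conj e He) in E.
    rewrite Cdiv_conj, Cminus_conj, (char_conj e He), Ropp_involutive by exact D.
    rewrite Cconj_RtoC.
    apply Ceq_minus.
    assert (E2 : Cmult (Cminus (RtoC 1) (e (- t)))
       (Cminus z (Cminus (Cdiv z0 (Cminus (RtoC 1) (e (- t))))
          (Cmult (e (2 * a)) (Cdiv (Cconj z0) (Cminus (RtoC 1) (e t)))))) = RtoC 0).
    (* From e(t) e(-t) = 1 follows 1 - e(t) = -e(t) (1 - e(-t)), which brings both fractions to one
       denominator. Since [field] sees e(t) and e(-t) as independent, the relation is supplied by
       hand. *)
    { replace (Cdiv (Cconj z0) (Cminus (RtoC 1) (e t)))
        with (Copp (Cdiv (Cmult (e (- t)) (Cconj z0)) (Cminus (RtoC 1) (e (- t))))).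
      - transitivity (Cminus (Cminus z (Cmult (e (- t)) z))
          (Cplus z0 (Cmult (e (2 * a)) (Cmult (e (- t)) (Cconj z0))))).
        + field; exact D.
        + rewrite E; ring.
      - apply Ceq_minus.
        replace (RtoC 0) with (Cmult (Cminus (RtoC 1) (Cmult (e t) (e (- t))))
          (Copp (Cdiv (Cconj z0) (Cmult (Cminus (RtoC 1) (e t)) (Cminus (RtoC 1) (e (- t))))))).
        + field; split; assumption.
        + rewrite Hinv; field; split; assumption. }
    apply Cmult_zero in E2; tauto.
  - assert (Hl := has_moment_minus _ _ _ _ _ Hz (has_moment_act e (false, t) _ _ He Hz)).
    assert (Hr := has_moment_minus _ _ _ _ _ H0 (has_moment_act e (false, a) _ _ He H0)).
    assert (E : Cminus z (mact e (false, t) z) = Cminus z0 (mact e (false, a) z0)).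
    { apply (has_moment_unique e _ _ _ He Hl).
      eapply has_moment_ext; [|exact Hr].
      intros x; unfold act; simpl.
      replace (x + a + t) with (x + t + a) by ring; ring. }
    unfold mact in *; simpl in *.
    transitivity (Cdiv (Cminus z (Cmult (e (- t)) z)) (Cminus (RtoC 1) (e (- t)))).
    + field; exact D.
    + rewrite E; field; exact D.
Qed.

(** If some almost-symmetric rotation acts nontrivially on moments, it determines the value.
    Otherwise all rotation moments vanish, so the value taken from one reflection suits every other,
    and without reflections 0 works. *)
Lemma regular_moment_exists e f : character e ->
  (forall z x, f (x + IZR z) = f x) -> exists S, regular_moment e f S.
Proof.
  intros He Hf.
  destruct (classic (exists t z, has_moment e (fun x => f x - f (x + t)) z /\ e t <> RtoC 1))
    as [(t & z & Hz & Ht)|N].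
  { eexists; apply (regular_moment_of_rotation e f t z He Hz Ht). }
  assert (Rot : forall t z, has_moment e (fun x => f x - f (x + t)) z ->
                  e t = RtoC 1 /\ z = RtoC 0).
  { intros t z Hz.
    assert (Ht : e t = RtoC 1) by (apply NNPP; intros Ht; apply N; eauto).
    split; [assumption|].
    (* Rotating by t twice is an integer shift, which preserves f. The two differences therefore
       cancel, giving z + z = 0. *)
    destruct (char_ker e He t Ht) as [n Hn].
    assert (Hs := has_moment_plus _ _ _ _ _ Hz (has_moment_act e (false, t) _ _ He Hz)).
    assert (E : Cplus z (mact e (false, t) z) = RtoC 0).
    { apply (has_moment_unique e _ _ _ He Hs).
      eapply has_moment_ext; [|apply has_moment_zero].
      intros x; unfold act; simpl.
      replace (x + t + t) with (x + IZR n) by lra; rewrite Hf; ring. }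
    pose proof (char_inv e t He) as Hi; rewrite Ht in Hi.
    assert (Hi' : e (- t) = RtoC 1) by (rewrite <- Hi; ring).
    unfold mact in E; simpl in E; rewrite Hi' in E.
    apply Cdouble_zero; rewrite <- E; ring. }
  assert (Rot' : forall t z S, has_moment e (fun x => f x - f (x + t)) z ->
                   z = Cminus S (mact e (false, t) S)).
  { intros t z S Hz; destruct (Rot t z Hz) as [Ht ->].
    pose proof (char_inv e t He) as Hi; rewrite Ht in Hi.
    assert (Hi' : e (- t) = RtoC 1) by (rewrite <- Hi; ring).
    unfold mact; simpl; rewrite Hi'; ring. }
  destruct (classic (exists a z, has_moment e (fun x => f x - f (act (true, a) x)) z))
    as [(a0 & z0 & H0)|N2].
  (* A reflection is an involution, so [mact] sends z0 to -z0, and S = z0/2 solves z0 = S -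
     mact(S). *)
  - exists (Cdiv z0 (RtoC 2)).
    assert (T : RtoC 2 <> RtoC 0) by (intros H; apply RtoC_inj in H; lra).
    assert (E0 : mact e (true, a0) z0 = Copp z0).
    { assert (Hs := has_moment_plus _ _ _ _ _ H0 (has_moment_act e (true, a0) _ _ He H0)).
      assert (E : Cplus z0 (mact e (true, a0) z0) = RtoC 0).
      { apply (has_moment_unique e _ _ _ He Hs).
        eapply has_moment_ext; [|apply has_moment_zero].
        intros x; unfold act; simpl.
        replace (- (- x + 2 * a0) + 2 * a0) with x by ring; ring. }
      replace (mact e (true, a0) z0)
        with (Cminus (Cplus z0 (mact e (true, a0) z0)) z0) by ring.
      rewrite E; ring. }
    intros [[] a] z Hz; [|apply Rot', Hz].
    (* The two reflections differ by a rotation, whose moment vanishes. *)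
    assert (Hd := has_moment_act e (true, a0) _ _ He
                    (has_moment_minus _ _ _ _ _ Hz H0)).
    destruct (Rot (2 * a - 2 * a0) (mact e (true, a0) (Cminus z z0))) as [Ht Hm].
    { eapply has_moment_ext; [|exact Hd].
      intros x; unfold act; simpl.
      replace (- (- x + 2 * a0) + 2 * a0) with x by ring.
      replace (- (- x + 2 * a0) + 2 * a) with (x + (2 * a - 2 * a0)) by ring; ring. }
    assert (Ea : e (2 * a) = e (2 * a0)).
    { replace (2 * a) with (2 * a0 + (2 * a - 2 * a0)) by ring.
      rewrite (char_plus e He), Ht; ring. }
    assert (Ez : z = z0).
    { unfold mact in Hm; simpl in Hm.
      pose proof (char_inv e (2 * a0) He) as Hi.
      apply Cmult_zero in Hm; destruct Hm as [Hm|Hm].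
      - rewrite Hm in Hi; exfalso.
        assert (RtoC 1 = RtoC 0) by (rewrite <- Hi; ring).
        apply RtoC_inj in H; lra.
      - apply Ceq_minus; rewrite <- (Cconj_conj (Cminus z z0)), Hm.
        apply Cconj_RtoC. }
    subst z; unfold mact in *; simpl in *; rewrite Ea, Cdiv_conj by exact T.
    rewrite Cconj_RtoC.
    transitivity (Cdiv (Cminus z0 (Cmult (e (2 * a0)) (Cconj z0))) (RtoC 2)).
    + rewrite E0; field; exact T.
    + field; exact T.
  - exists (RtoC 0); intros [[] a] z Hz; [exfalso; eauto|apply Rot', Hz].
Qed.

(** S + w serves as the regularised moment of f + s. Invariance gives f(x) - f(gx) = s(gx) - s(x),
    whose moment can be expressed through either S or w. *)
Lemma regular_moment_fixed e f s g S w : character e ->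
  regular_moment e f S -> has_moment e s w ->
  (forall x, f (act g x) + s (act g x) = f x + s x) ->
  Cplus S w = mact e g (Cplus S w).
Proof.
  intros He HS Hs H.
  assert (E : Cminus (mact e g w) w = Cminus S (mact e g S)).
  { apply HS; eapply has_moment_ext;
      [|apply has_moment_minus; [apply has_moment_act; eassumption|eassumption]].
    intros x; specialize (H x); simpl; lra. }
  apply Ceq_minus.
  transitivity (Cminus (Cminus S (mact e g S)) (Cminus (mact e g w) w)).
  - rewrite mact_plus; ring.
  - rewrite E; ring.
Qed.

(** * Scalene triples *)

(* [2i Im (Z2 * conj Z1 ^ 2)] *)
Definition skew (Z1 Z2 : C) : C :=
  Cminus (Cmult Z2 (Cmult (Cconj Z1) (Cconj Z1))) (Cmult (Cconj Z2) (Cmult Z1 Z1)).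

(** For a reflection, Z1^2 and Z2 are both cis(4a) times their own conjugates, so the two products
    agree. A nontrivial rotation fixes only Z1 = 0. *)
Lemma skew_fixed g Z1 Z2 : ~ is_identity g ->
  Z1 = mact cis g Z1 -> Z2 = mact (fun x => cis (2 * x)) g Z2 -> skew Z1 Z2 = RtoC 0.
Proof.
  intros Hg H1 H2; destruct g as [[] a]; unfold mact in *; simpl in *.
  - assert (H2' : Z2 = Cmult (Cmult (cis (2 * a)) (cis (2 * a))) (Cconj Z2)).
    { rewrite <- cis_plus; replace (2 * a + 2 * a) with (2 * (2 * a)) by ring; exact H2. }
    assert (E1 : Cmult Z1 Z1 = Cmult (Cmult (cis (2 * a)) (cis (2 * a)))
                                 (Cmult (Cconj Z1) (Cconj Z1))).
    { rewrite H1 at 1 2; ring. }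
    unfold skew; rewrite E1; rewrite H2' at 1; ring.
  - assert (Z1 = RtoC 0).
    { assert (E : Cmult (Cminus (RtoC 1) (cis (- a))) Z1 = RtoC 0).
      { transitivity (Cminus Z1 (Cmult (cis (- a)) Z1)); [ring|rewrite <- H1; ring]. }
      apply Cmult_zero in E; destruct E as [E|E]; [|assumption].
      destruct Hg; apply Ceq_minus in E; symmetry in E.
      apply cis_eq_1 in E; destruct E as [z Hz].
      intros x; exists (- z)%Z; unfold act; simpl; rewrite opp_IZR; lra. }
    subst Z1; unfold skew.
    rewrite Cconj_RtoC.
    ring.
Qed.

(** 2a = b + c modulo 1 says that the reflection about a swaps b and c. Equilateral triples are
    included. *)
Definition isosceles (a b c : R) : Prop :=
  cong1 (2 * a) (b + c) \/ cong1 (2 * b) (a + c) \/ cong1 (2 * c) (a + b).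

Definition b2R (b : bool) : R := if b then 1 else 0.

Definition recolor (p : R) (b : bool) (c : R -> bool) (x : R) : bool :=
  if excluded_middle_informative (cong1 x p) then b else c x.

Lemma recolor_coloring p b c : coloring c -> coloring (recolor p b c).
Proof.
  intros H x; unfold recolor.
  assert (E : cong1 (x + 1) p <-> cong1 x p).
  { split; intros [z Hz]; [exists (z - 1)%Z; rewrite minus_IZR
                          |exists (z + 1)%Z; rewrite plus_IZR]; lra. }
  destruct excluded_middle_informative; destruct excluded_middle_informative;
    try tauto; apply H.
Qed.

(** [skew] has total degree 3 in the real weights u, v, w, so the mixed difference over the cube
    keeps only the coefficient of uvw. Hence S1 and S2 drop out; the factor 2 comes from the square
    of Z1. *)
Lemma third_difference (S1 S2 a b c a2 b2 c2 : C)
  (f := fun u v w : R =>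
     skew (Cplus S1 (Cplus (Cmult (RtoC u) a) (Cplus (Cmult (RtoC v) b) (Cmult (RtoC w) c))))
          (Cplus S2 (Cplus (Cmult (RtoC u) a2) (Cplus (Cmult (RtoC v) b2) (Cmult (RtoC w) c2))))) :
  Cminus (Cplus (f 1 1 1) (Cplus (f 1 0 0) (Cplus (f 0 1 0) (f 0 0 1))))
         (Cplus (f 0 0 0) (Cplus (f 1 1 0) (Cplus (f 1 0 1) (f 0 1 1)))) =
  Cmult (RtoC 2)
    (Cminus
      (Cplus (Cmult a2 (Cmult (Cconj b) (Cconj c)))
      (Cplus (Cmult b2 (Cmult (Cconj a) (Cconj c)))
             (Cmult c2 (Cmult (Cconj a) (Cconj b)))))
      (Cplus (Cmult (Cconj a2) (Cmult b c))
      (Cplus (Cmult (Cconj b2) (Cmult a c))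
             (Cmult (Cconj c2) (Cmult a b))))).
Proof.
  unfold f, skew; repeat rewrite ?Cplus_conj, ?Cmult_conj, ?Cconj_RtoC; ring.
Qed.

Lemma cis_double_eq x y z : cis (2 * x) = Cmult (cis y) (cis z) -> cong1 (2 * x) (y + z).
Proof.
  intros H.
  assert (E : cis (2 * x + - (y + z)) = RtoC 1).
  { rewrite cis_plus, H, <- cis_plus; apply char_inv, cis_character. }
  apply cis_eq_1 in E; destruct E as [n Hn]; exists n; lra.
Qed.

(** The two sides are complex conjugates. Multiplied by (ABD)^2, their difference factors as (A^2 -
    BD)(B^2 - AD)(D^2 - AB), and each factor vanishes for one choice of apex. *)
Lemma isosceles_of_cubic a b c
  (Q := fun p q r => Cmult (cis (2 * p)) (Cmult (cis (- q)) (cis (- r)))) :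
  Cplus (Q a b c) (Cplus (Q b a c) (Q c a b)) =
  Cplus (Q (- a) (- b) (- c)) (Cplus (Q (- b) (- a) (- c)) (Q (- c) (- a) (- b))) ->
  isosceles a b c.
Proof.
  unfold Q; intros H.
  assert (I : forall x, cis (2 * x) = Cmult (cis x) (cis x)).
  { intros x; rewrite <- cis_plus; f_equal; ring. }
  rewrite !I, !Ropp_involutive in H.
  pose proof (char_inv cis a cis_character) as Ha.
  pose proof (char_inv cis b cis_character) as Hb.
  pose proof (char_inv cis c cis_character) as Hc.
  set (A := cis a) in *; set (B := cis b) in *; set (D := cis c) in *.
  set (A' := cis (- a)) in *; set (B' := cis (- b)) in *; set (D' := cis (- c)) in *.
  assert (E : Cmult (Cminus (Cmult A A) (Cmult B D))
               (Cmult (Cminus (Cmult B B) (Cmult A D)) (Cminus (Cmult D D) (Cmult A B)))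
              = RtoC 0).
  { (* clear the inverses A', B', D' by multiplying with (ABD)^2 *)
    transitivity (Cmult (Cmult (Cmult A A) (Cmult (Cmult B B) (Cmult D D)))
      (Cminus
        (Cplus (Cmult (Cmult A A) (Cmult B' D'))
           (Cplus (Cmult (Cmult B B) (Cmult A' D')) (Cmult (Cmult D D) (Cmult A' B'))))
        (Cplus (Cmult (Cmult A' A') (Cmult B D))
           (Cplus (Cmult (Cmult B' B') (Cmult A D)) (Cmult (Cmult D' D') (Cmult A B)))))).
    - transitivity (Cminus
        (Cplus (Cmult (Cmult A (Cmult A (Cmult A A))) (Cmult (Cmult B (Cmult B B')) (Cmult D (Cmult D D'))))
        (Cplus (Cmult (Cmult B (Cmult B (Cmult B B))) (Cmult (Cmult A (Cmult A A')) (Cmult D (Cmult D D'))))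
               (Cmult (Cmult D (Cmult D (Cmult D D))) (Cmult (Cmult A (Cmult A A')) (Cmult B (Cmult B B'))))))
        (Cplus (Cmult (Cmult (Cmult A A') (Cmult A A')) (Cmult (Cmult B (Cmult B B)) (Cmult D (Cmult D D))))
        (Cplus (Cmult (Cmult (Cmult B B') (Cmult B B')) (Cmult (Cmult A (Cmult A A)) (Cmult D (Cmult D D))))
               (Cmult (Cmult (Cmult D D') (Cmult D D')) (Cmult (Cmult A (Cmult A A)) (Cmult B (Cmult B B))))))).
      + rewrite Ha, Hb, Hc; ring.
      + ring.
    - rewrite H; ring. }
  unfold isosceles.
  apply Cmult_zero in E; destruct E as [E|E];
    [left|apply Cmult_zero in E; destruct E as [E|E]; [right; left|right; right]];
    apply cis_double_eq; rewrite I; apply Ceq_minus, E.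
Qed.

Lemma scalene_P W a b c : In a W -> In b W -> In c W ->
  ~ cong1 a b -> ~ cong1 a c -> ~ cong1 b c -> ~ isosceles a b c -> P W.
Proof.
  intros Wa Wb Wc Hab Hac Hbc Hs k Hk.
  set (k' := fun u v w => recolor a u (recolor b v (recolor c w k))).
  assert (Ck : forall u v w, coloring (k' u v w)).
  { intros; unfold k'; repeat apply recolor_coloring; exact Hk. }
  apply NNPP; intros N.
  assert (Sym : forall u v w, exists g, (forall x, k' u v w (act g x) = k' u v w x)
                                        /\ ~ is_identity g).
  { intros u v w; apply NNPP; intros N2; apply N; exists (k' u v w); split; [apply Ck|split].
    - intros x Hx; unfold k', recolor.
      repeat (destruct excluded_middle_informative as [h|h];
        [exfalso; apply Hx; eexists; split; [|exact h]; assumption|clear h]).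
      reflexivity.
    - intros g Hg; apply NNPP; intros Hn; apply N2; exists g; split; assumption. }
  (* With all three points set to [false], every recoloring becomes f plus indicators of some of a,
     b, c. Their distinctness modulo 1 makes this sum exact. *)
  set (f := fun x => b2R (k' false false false x)).
  assert (Hf : forall u v w x, b2R (k' u v w x) =
             f x + (b2R u * ind a x + (b2R v * ind b x + b2R w * ind c x))).
  { intros u v w x; unfold f, k', recolor, ind.
    repeat destruct excluded_middle_informative;
      try (exfalso; eauto using cong1_trans, cong1_sym; fail); simpl; ring. }
  assert (Pf : forall z x, f (x + IZR z) = f x).
  { intros z x; unfold f; rewrite coloring_Z; [reflexivity|apply Ck]. }
  destruct (regular_moment_exists cis f cis_character Pf) as [S1 HS1].
  destruct (regular_moment_exists _ f cis2_character Pf) as [S2 HS2].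
  assert (M : forall e u v w,
    has_moment e (fun x => b2R u * ind a x + (b2R v * ind b x + b2R w * ind c x))
      (Cplus (Cmult (RtoC (b2R u)) (e a))
         (Cplus (Cmult (RtoC (b2R v)) (e b)) (Cmult (RtoC (b2R w)) (e c))))).
  { intros; repeat apply has_moment_plus; apply has_moment_scale, has_moment_ind. }
  (* The symmetry of each recoloring fixes both of its regularised moments, so [skew] vanishes at
     all eight corners of the cube. *)
  assert (Z : forall u v w, skew
    (Cplus S1 (Cplus (Cmult (RtoC (b2R u)) (cis a))
       (Cplus (Cmult (RtoC (b2R v)) (cis b)) (Cmult (RtoC (b2R w)) (cis c)))))
    (Cplus S2 (Cplus (Cmult (RtoC (b2R u)) (cis (2 * a)))
       (Cplus (Cmult (RtoC (b2R v)) (cis (2 * b))) (Cmult (RtoC (b2R w)) (cis (2 * c))))))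
    = RtoC 0).
  { intros u v w; destruct (Sym u v w) as (g & Hg & Ng).
    apply (skew_fixed g); [exact Ng| |].
    - apply (regular_moment_fixed cis f _ g S1 _ cis_character HS1 (M _ u v w)).
      intros x; rewrite <- !Hf, Hg; reflexivity.
    - apply (regular_moment_fixed _ f _ g S2 _ cis2_character HS2 (M (fun x => cis (2 * x)) u v w)).
      intros x; rewrite <- !Hf, Hg; reflexivity. }
  apply Hs, isosceles_of_cubic.
  pose proof (third_difference S1 S2 (cis a) (cis b) (cis c)
                (cis (2 * a)) (cis (2 * b)) (cis (2 * c))) as T.
  cbv zeta beta in T.
  pose proof (Z true true true) as Z1; pose proof (Z true false false) as Z2.
  pose proof (Z false true false) as Z3; pose proof (Z false false true) as Z4.
  pose proof (Z false false false) as Z5; pose proof (Z true true false) as Z6.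
  pose proof (Z true false true) as Z7; pose proof (Z false true true) as Z8.
  cbv [b2R] in Z1, Z2, Z3, Z4, Z5, Z6, Z7, Z8.
  rewrite Z1, Z2, Z3, Z4, Z5, Z6, Z7, Z8, !cis_conj in T.
  apply Ceq_minus.
  rewrite !Ropp_mult_distr_r_reverse in *.
  symmetry in T; match type of T with _ = ?r => replace r with (RtoC 0) in T by ring end.
  apply Cmult_zero in T; destruct T as [T|T]; [apply RtoC_inj in T; lra|].
  rewrite !Ropp_involutive; exact T.
Qed.

(** * Five points whose triples are all isosceles *)

Lemma sort_exists (L : list R) : exists L', Permutation L L' /\ StronglySorted Rle L'.
Proof.
  induction L as [|x L (L' & HP & HS)].
  - exists nil; split; constructor.
  - assert (Ins : exists L2, Permutation (x :: L') L2 /\ StronglySorted Rle L2).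
    { clear HP; induction HS as [|y M HM (L2 & HP & HS2) HF].
      - exists (x :: nil); split; [reflexivity|repeat constructor].
      - destruct (Rle_dec x y) as [h|h].
        + exists (x :: y :: M); split; [reflexivity|].
          constructor; [constructor; assumption|].
          constructor; [assumption|].
          eapply Forall_impl; [|exact HF]; simpl; intros; lra.
        + exists (y :: L2); split.
          * rewrite <- HP; apply perm_swap.
          * constructor; [assumption|].
            rewrite <- HP; constructor; [lra|assumption]. }
    destruct Ins as (L2 & HP2 & HS2); exists L2; split; [|assumption].
    rewrite <- HP2; constructor; assumption.
Qed.

Lemma cong1_unit_interval x : exists y, cong1 x y /\ 0 <= y < 1.
Proof.
  exists (x - IZR (up x - 1)); split.
  - exists (up x - 1)%Z; lra.
  - rewrite minus_IZR; destruct (archimed x); lra.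
Qed.

Lemma Z_bounds_0 x z : x = IZR z -> -1 < x < 1 -> x = 0.
Proof.
  intros -> [H1 H2]; apply lt_IZR in H1; apply lt_IZR in H2.
  replace z with 0%Z by lia; reflexivity.
Qed.

(** The three left-hand sides lie in (-2,0), (-1,1) and (0,2), each of which contains a single
    integer. *)
Lemma isosceles_sorted p q r : 0 <= p -> p < q -> q < r -> r < 1 -> isosceles p q r ->
  2 * p - q - r = -1 \/ 2 * q - p - r = 0 \/ 2 * r - p - q = 1.
Proof.
  intros H0 H1 H2 H3 [[z Hz]|[[z Hz]|[z Hz]]].
  - left; assert (2 * p - q - r + 1 = 0); [|lra].
    apply (Z_bounds_0 _ (z + 1)); [rewrite plus_IZR|]; lra.
  - right; left; apply (Z_bounds_0 _ z); lra.
  - right; right; assert (2 * r - p - q - 1 = 0); [|lra].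
    apply (Z_bounds_0 _ (z - 1)); [rewrite minus_IZR|]; lra.
Qed.

Ltac split_triple t :=
  apply isosceles_sorted in t; [destruct t as [t|[t|t]]; try (exfalso; lra)|lra..].

(** Each triple cuts the circle into three arcs, two of which are equal: a linear equation. Every
    combination of the ten equations compatible with the order forces all gaps to be 1/5. *)
Lemma five_isosceles p0 p1 p2 p3 p4 :
  0 <= p0 -> p0 < p1 -> p1 < p2 -> p2 < p3 -> p3 < p4 -> p4 < 1 ->
  isosceles p0 p1 p2 -> isosceles p0 p1 p3 -> isosceles p0 p1 p4 ->
  isosceles p0 p2 p3 -> isosceles p0 p2 p4 -> isosceles p0 p3 p4 ->
  isosceles p1 p2 p3 -> isosceles p1 p2 p4 -> isosceles p1 p3 p4 ->
  isosceles p2 p3 p4 ->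
  p1 = p0 + 1/5 /\ p2 = p0 + 2/5 /\ p3 = p0 + 3/5 /\ p4 = p0 + 4/5.
Proof.
  intros h0 h1 h2 h3 h4 h5 t1 t2 t3 t4 t5 t6 t7 t8 t9 t10.
  (* The triples are converted one at a time, since lra would split pending disjunctions. *)
  split_triple t1; split_triple t2; split_triple t3; split_triple t4; split_triple t5;
  split_triple t6; split_triple t7; split_triple t8; split_triple t9; split_triple t10;
  repeat split; lra.
Qed.

Lemma isosceles_cong1 a b c a' b' c' : cong1 a a' -> cong1 b b' -> cong1 c c' ->
  isosceles a b c -> isosceles a' b' c'.
Proof.
  intros [i ->] [j ->] [k ->] [[z Hz]|[[z Hz]|[z Hz]]];
    [left; exists (z + j + k - 2 * i)%Z
    |right; left; exists (z + i + k - 2 * j)%Z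
    |right; right; exists (z + i + j - 2 * k)%Z];
    rewrite minus_IZR, !plus_IZR, mult_IZR; lra.
Qed.

(** In [0,1) congruence is equality, so the points can be sorted and distinctness modulo 1 becomes
    [NoDup]. *)
Lemma unit_representatives (W : list R) : exists V,
  (forall x, inW W x <-> inW V x) /\ length V = length W /\
  Forall (fun v => 0 <= v < 1) V /\ (distinct_pts W -> NoDup V).
Proof.
  induction W as [|w W (V & HV & Hl & HF & HN)].
  - exists nil; repeat split; try constructor; intros [? [[] _]].
  - destruct (cong1_unit_interval w) as (v & Hv & Hb).
    exists (v :: V); repeat split; simpl.
    + intros (y & [<-|Hy] & Hx).
      * exists v; split; [left; reflexivity|eapply cong1_trans; eauto].
      * destruct (proj1 (HV x)) as (y' & Hy' & Hx'); [exists y; auto|].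
        exists y'; split; [right|]; assumption.
    + intros (y & [<-|Hy] & Hx).
      * exists w; split; [left; reflexivity|eapply cong1_trans; eauto using cong1_sym].
      * destruct (proj2 (HV x)) as (y' & Hy' & Hx'); [exists y; auto|].
        exists y'; split; [right|]; assumption.
    + congruence.
    + constructor; assumption.
    + intros D; constructor.
      * intros Hin.
        destruct (proj2 (HV v)) as (y & Hy & Hx); [exists v; split; [|apply cong1_refl]; auto|].
        destruct (In_nth W y 0 Hy) as (n & Hn & E).
        apply (D 0%nat (S n)); simpl; try lia.
        rewrite E; eapply cong1_trans; eauto.
      * apply HN; intros i j Hi Hj Hij.
        apply (D (S i) (S j)); simpl; lia.
Qed.

Lemma nonpentagon_scalene W :
  length W = 5%nat -> distinct_pts W -> ~ congruent W pentagon ->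
  exists a b c, In a W /\ In b W /\ In c W /\
    ~ cong1 a b /\ ~ cong1 a c /\ ~ cong1 b c /\ ~ isosceles a b c.
Proof.
  intros Hlen Hd Hp.
  destruct (unit_representatives W) as (V & HV & Hl & HF & HN); specialize (HN Hd).
  destruct (sort_exists V) as (L & HP & HS).
  assert (HV' : forall x, inW W x <-> inW L x).
  { intros x; rewrite HV; split; intros (y & Hy & Hx); exists y; split; auto;
      [eapply Permutation_in; eauto|eapply Permutation_in; [symmetry|]; eauto]. }
  assert (Hl5 : length L = 5%nat) by (rewrite <- (Permutation_length HP); congruence).
  rewrite HP in HF, HN.
  apply NNPP; intros N.
  assert (Iso : forall p q r, In p L -> In q L -> In r L ->
            p <> q -> p <> r -> q <> r -> isosceles p q r).
  { intros p q r Ip Iq Ir Epq Epr Eqr; apply NNPP; intros Ni; apply N.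
    assert (U : forall s t, In s L -> In t L -> cong1 s t -> s = t).
    { intros s t Is It [z Hz]; rewrite Forall_forall in HF.
      pose proof (HF s Is); pose proof (HF t It).
      assert (s - t = 0) by (apply (Z_bounds_0 _ z); lra); lra. }
    (* The scalene triple has to consist of entries of [W] itself, so each sorted representative is
       traced back to one. *)
    assert (B : forall s, In s L -> exists w, In w W /\ cong1 s w).
    { intros s Is; apply HV'; exists s; split; [assumption|apply cong1_refl]. }
    destruct (B p Ip) as (a & Wa & Ha); destruct (B q Iq) as (b & Wb & Hb);
      destruct (B r Ir) as (c & Wc & Hc).
    exists a, b, c; repeat split; try assumption.
    - intros H; apply Epq, U; eauto using cong1_trans, cong1_sym.
    - intros H; apply Epr, U; eauto using cong1_trans, cong1_sym.
    - intros H; apply Eqr, U; eauto using cong1_trans, cong1_sym.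
    - intros H; apply Ni; eapply isosceles_cong1; [..|exact H]; apply cong1_sym; assumption. }
  destruct L as [|p0 [|p1 [|p2 [|p3 [|p4 [|]]]]]]; try discriminate Hl5.
  assert (Lt : p0 < p1 /\ p1 < p2 /\ p2 < p3 /\ p3 < p4).
  { repeat match goal with
    | H : StronglySorted _ (_ :: _) |- _ => apply StronglySorted_inv in H as [? ?]
    | H : Forall _ (_ :: _) |- _ => apply Forall_cons_iff in H as [? ?]
    | H : NoDup (_ :: _) |- _ => apply NoDup_cons_iff in H as [? ?]
    end.
    simpl in *; repeat split; apply Rnot_le_lt; intros Hle;
      match goal with H : ~ (?q = ?p \/ _) |- _ =>
        apply H; left; apply Rle_antisym; assumption end. }
  destruct Lt as (h1 & h2 & h3 & h4).
  assert (h0 : 0 <= p0) by (inversion_clear HF; tauto).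
  assert (h5 : p4 < 1).
  { rewrite Forall_forall in HF; apply HF; simpl; tauto. }
  assert (HI := five_isosceles p0 p1 p2 p3 p4).
  destruct HI as (E1 & E2 & E3 & E4); try assumption;
    try (apply Iso; simpl; try tauto; lra).
  (* The rotation by -p0 takes the smallest representative to the vertex 0. *)
  apply Hp; exists (false, - p0); intros x; unfold act; simpl.
  assert (Shift : inW (p0 :: p1 :: p2 :: p3 :: p4 :: nil) (x + p0) <-> inW pentagon x).
  { subst; unfold inW, pentagon; simpl;
      split; intros (y & [<-|[<-|[<-|[<-|[<-|[]]]]]] & z & Hz);
      [exists 0|exists (1/5)|exists (2/5)|exists (3/5)|exists (4/5)
      |exists p0|exists (p0 + 1/5)|exists (p0 + 2/5)|exists (p0 + 3/5)|exists (p0 + 4/5)];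
      (split; [tauto|exists z; lra]). }
  rewrite <- Shift, <- HV'; split;
    intros (w & Hw & z & Hz); exists w; (split; [assumption|exists z; lra]).
Qed.

(** * Trivial stabilizer and conclusion *)

Lemma distinct_trivial_stab W :
  (3 <= length W)%nat -> distinct_pts W -> trivial_stab W.
Proof.
  intros Hl Hd [[] a] Hg; unfold act in Hg; simpl in Hg.
  - exfalso.
    (* A point w fixed by the reflection satisfies 2w = 2a - m with m an integer, and the parity of
       m determines w modulo 1. Among three fixed points two parities agree, contradicting
       distinctness. *)
    assert (K : forall i j, (i < 3)%nat -> (j < 3)%nat -> i <> j -> forall m n,
      - nth i W 0 + 2 * a = nth i W 0 + IZR m ->
      - nth j W 0 + 2 * a = nth j W 0 + IZR n -> Z.even m = Z.even n -> False).
    { intros i j Hi Hj Hij m n Hm Hn E.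
      apply (Hd i j); try lia.
      assert (exists d, n = m + 2 * d)%Z as [d ->].
      { assert (Ee : Z.even (n - m) = true).
        { rewrite Z.even_sub, E; destruct (Z.even n); reflexivity. }
        apply Z.even_spec in Ee; destruct Ee as [d Hd']; exists d; lia. }
      exists d; rewrite plus_IZR, mult_IZR in Hn; lra. }
    destruct (Hg (nth 0 W 0)) as [z0 H0]; [apply nth_In; lia|].
    destruct (Hg (nth 1 W 0)) as [z1 H1]; [apply nth_In; lia|].
    destruct (Hg (nth 2 W 0)) as [z2 H2]; [apply nth_In; lia|].
    pose proof (K 0%nat 1%nat ltac:(lia) ltac:(lia) ltac:(lia) _ _ H0 H1).
    pose proof (K 0%nat 2%nat ltac:(lia) ltac:(lia) ltac:(lia) _ _ H0 H2).
    pose proof (K 1%nat 2%nat ltac:(lia) ltac:(lia) ltac:(lia) _ _ H1 H2).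
    destruct (Z.even z0), (Z.even z1), (Z.even z2); tauto.
  - destruct (Hg (nth 0 W 0)) as [z Hz]; [apply nth_In; lia|].
    intros x; exists z; unfold act; simpl; lra.
Qed.

Theorem theorem2p4p4 (W : list R) :
  length W = 5%nat -> distinct_pts W -> ~ congruent W pentagon ->
  trivial_stab W /\ P W.
Proof.
  intros Hl Hd Hp; split.
  - apply distinct_trivial_stab; [lia|assumption].
  - destruct (nonpentagon_scalene W Hl Hd Hp)
      as (a & b & c & Wa & Wb & Wc & Hab & Hac & Hbc & Hs).
    exact (scalene_P W a b c Wa Wb Wc Hab Hac Hbc Hs).
Qed.
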